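(* Let $\mathbb{F}_q$ be a finite field of characteristic at least $5$ and let $\mathcal{F}=\mathbb{F}_q(x,y)$ with $y^3=A^2y+1$ for some non-constant $A\in\mathbb{F}_q[x]$. Suppose that $D=4A^6-27$ is squarefree in $\mathbb{F}_q[x]$ and that there is no $\alpha\in\mathcal{O}^*$ with $\deg(A)<\alpha_{max}<2\deg(A)$. Then $\mathcal{F}$ has unit rank $2$ and $\{y,\,A+y\}$ is a fundamental system.
   Context: $\mathcal{O}$ is the integral closure of $\mathbb{F}_q[x]$ in $\mathcal{F}$; since $D$ is squarefree, $\{1,y,y^2\}$ is an $\mathbb{F}_q[x]$-basis of $\mathcal{O}$. $\mathcal{O}^*=\mathbb{F}_q^*\times\mathcal{E}$ with $\mathcal{E}$ free abelian of finite rank, this rank being the unit rank; a fundamental system is a set of independent units generating $\mathcal{O}^*$ modulo $\mathbb{F}_q^*$. Maximum value: there are places $P'$ of $\mathcal{F}$ above the infinite place $P_\infty$ of $\mathbb{F}_q(x)$ with $v_{P'}(y)=-e(P'|P_\infty)\deg(A)$; let $P_1$ be one with minimal ramification index. For $\alpha=a_0+a_1y+a_2y^2\in\mathcal{O}$ with $a_i\in\mathbb{F}_q[x]$, $$\alpha_{max}=\max\{-v_{P_1}(a_0),-v_{P_1}(a_1y),-v_{P_1}(a_2y^2)\},$$ which here equals $\max\{\deg a_0,\ \deg a_1+\deg A,\ \deg a_2+2\deg A\}$ (with $\deg 0=-\infty$). *)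

(* Defs.v *)
From HB Require Import structures.
From mathcomp Require Import all_boot all_order all_algebra all_field.
From mathcomp Require Import constructive_ereal.

Set Implicit Arguments.
Unset Strict Implicit.
Unset Printing Implicit Defensive.

Import Order.TTheory GRing.Theory Num.Theory.
Local Open Scope ring_scope.

(* The degree of a nonzero polynomial (junk value 0 at the zero polynomial). *)
Definition deg (F : finFieldType) (p : {poly F}) : int := (size p).-1%:Z.

(* Same form as the condition in [separable.poly_square_freeP]; a squarefree
   polynomial is in particular nonzero (take u = 0). *)
Definition squarefree (F : finFieldType) (p : {poly F}) : Prop :=
  forall u : {poly F}, size u != 1%N -> ~~ (u ^+ 2 %| p).

Section FunctionField.

Variables (F : finFieldType) (L : fieldExtType {fraction {poly F}}).
Implicit Types (u w y : L) (v : L -> \bar int).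

Definition emb (p : {poly F}) : L := (tofrac p)%:A.

Definition const_unit u : Prop := exists2 c : F, c != 0 & u = emb c%:P.

Definition in_order u : Prop := integralOver emb u.

Definition order_unit u : Prop :=
  in_order u /\ exists2 w, in_order w & u * w = 1.

Definition monomial (r : nat) (s : r.-tuple L) (k : 'I_r -> int) : L :=
  \prod_(i < r) tnth s i ^ k i.

Definition independent (r : nat) (s : r.-tuple L) : Prop :=
  forall k : 'I_r -> int, monomial s k = 1 -> forall i, k i = 0.

Definition fundamental_system (r : nat) (s : r.-tuple L) : Prop :=
  [/\ forall i, order_unit (tnth s i),
      independent s
    & forall u, order_unit u ->
        exists c (k : 'I_r -> int), const_unit c /\ u = c * monomial s k].

Definition free_abelian_of_rank (E : L -> Prop) (r : nat) : Prop :=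
  exists b : r.-tuple L,
    [/\ forall i, tnth b i != 0,
        independent b
      & forall u, E u <-> exists k : 'I_r -> int, u = monomial b k].

(* E is a complement of F^* in the unit group; it is not unique, but its rank
   is the rank of the unit group modulo F^*. *)
Definition unit_rank (r : nat) : Prop :=
  exists E : L -> Prop,
    [/\ forall u, E u -> order_unit u,
        forall u, E u -> const_unit u -> u = 1,
        forall u, order_unit u ->
          exists c w, [/\ const_unit c, E w & u = c * w]
      & free_abelian_of_rank E r].

(* Places are represented by their normalized discrete valuations, with
   v 0 = +oo and all other values finite. *)
Definition place v : Prop :=
  [/\ forall u, (v u = +oo%E <-> u = 0) /\ v u <> -oo%E,
      forall u w, v (u * w) = (v u + v w)%E,
      forall u w, (mine (v u) (v w) <= v (u + w)%R)%E,
      forall u, const_unit u -> v u = 0%E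
    & exists u, v u = 1%:E].

(* v lies above the infinite place of F(x), whose valuation sends p / q to
   deg q - deg p, with ramification index e. *)
Definition above_infinity v (e : nat) : Prop :=
  (0 < e)%N /\
  forall p q : {poly F}, p != 0 -> q != 0 ->
    v (emb p / emb q) = (e%:Z * (deg q - deg p))%:E.

Definition y_pole_place (A : {poly F}) y v (e : nat) : Prop :=
  [/\ place v, above_infinity v e & v y = (- (e%:Z * deg A))%:E].

Definition minimal_place (A : {poly F}) y v : Prop :=
  exists2 e, y_pole_place A y v e &
    forall v' e', y_pole_place A y v' e' -> (e <= e')%N.

(* The maximum value of a0 + a1 y + a2 y^2; a zero term contributes -oo. *)
Definition max_value v y (a0 a1 a2 : {poly F}) : \bar int :=
  maxe (- v (emb a0))%E
    (maxe (- v (emb a1 * y)%R)%E (- v (emb a2 * y ^+ 2)%R)%E).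

End FunctionField.

(* Main.v *)
Require Import Defs.
From HB Require Import structures.
From mathcomp Require Import all_boot all_order all_algebra all_field.
From mathcomp Require Import constructive_ereal.
From mathcomp Require Import zify ring.
From Stdlib Require Import Classical_Prop.

(** Write $a = deg A$ and let $alpha = a_0 + a_1 y + a_2 y^2$ have polynomial
    coefficients. At infinity the three conjugates of $y$ are close to $A$,
    $-A$ and $0$, so the sizes of $alpha$ at the three infinite places are
    governed by the values of $a_0 + a_1 Y + a_2 Y^2$ at $Y = A, -A, 0$
    ([value3]). These three values determine the $a_i$ because 2 is
    invertible, and their product is the norm of $alpha$ up to the small error
    term [rem3]. The whole argument is thus an estimate on degrees of
    polynomials.

    Generation. On the logarithmic scale the units $y$, $y + A$, $y - A$, whose
    product is 1, have degree $-2a$ at one place and $a$ at the two others. Let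
    $alpha$ have constant norm and let $m > a$ be the largest degree of its
    three values. If one value has degree below $m - 2a$, then dividing by the
    unit which is small at that place makes $m$ drop. Otherwise the norm
    relation forces the two values other than the largest one to have degree
    below $m - a$, and multiplying by the unit which is small at the place of
    the largest value makes $m$ drop ([values3_size], [descent_step]). The
    descent ends with $m <= a$, where $alpha = a_0 + c y$ with $c$ constant, and
    $a_0 (a_0 - c A) (a_0 + c A)$ has to be a constant; only constants and
    constant multiples of $y$, $y + A$, $y - A$ satisfy this ([descent_base]).

    Independence. A product $y^n (A+y)^m$ with $n, m >= 0$ is as large as
    possible at the place where $y$ is close to $A$: its degree there is
    $(n+m) a$ ([leading_power]). Hence a relation between powers of $y$ and
    $A + y$ has the form $y^n = (A+y)^n$, and comparing both sides at the
    place where $y$ is close to $-A$ gives $n = 0$ ([power_independent]).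

    Integral basis. If $u = b_0 + b_1 y + b_2 y^2$ is integral with rational
    coefficients, replacing one element of the basis $1, y, y^2$ by $u$
    multiplies its discriminant $D$ by the square of the corresponding $b_i$,
    and the result is integral, hence a polynomial. As $D$ is squarefree, $b_i$
    has no denominator ([squarefree_frac], [integral_basis]). So every unit is
    an $alpha$ as above, and its norm is a constant ([norm3_unit]). *)

Set Implicit Arguments.
Unset Strict Implicit.
Unset Printing Implicit Defensive.

Import Order.TTheory GRing.Theory Num.Theory.
Local Open Scope ring_scope.

(** * Coordinates on the basis 1, y, y^2 *)

Section Triples.

Variable R : comNzRingType.
Implicit Types (A : R) (a b : R * R * R).

(** The product of two elements given by their coordinates, for
    $y^3 = A^2 y + 1$. *)
Definition mul3 A a b : R * R * R :=
  let: (a0, a1, a2) := a in let: (b0, b1, b2) := b in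
  (a0 * b0 + (a1 * b2 + a2 * b1),
   a0 * b1 + a1 * b0 + A ^+ 2 * (a1 * b2 + a2 * b1) + a2 * b2,
   a0 * b2 + a1 * b1 + a2 * b0 + A ^+ 2 * (a2 * b2)).

Definition value3 e a : R := let: (a0, a1, a2) := a in a0 + e * a1 + e ^+ 2 * a2.

(** The norm of $a_0 + a_1 y + a_2 y^2$ is its resultant with
    $Y (Y - A) (Y + A) - 1$. Without the last term the resultant would be the
    product of the values at $A$, $-A$ and $0$; [rem3] is the correction. *)
Definition rem3 A a : R :=
  let: (a0, a1, a2) := a in
  a1 ^+ 3 - 3%:R * a0 * a1 * a2 - A ^+ 2 * a1 * a2 ^+ 2 + a2 ^+ 3.

Definition norm3 A a : R :=
  value3 A a * value3 (- A) a * value3 0 a + rem3 A a.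

Lemma norm3M A a b : norm3 A (mul3 A a b) = norm3 A a * norm3 A b.
Proof.
case: a => -[a0 a1] a2; case: b => -[b0 b1] b2.
by rewrite /norm3 /rem3 /value3 /mul3; ring.
Qed.

Lemma mul3N A : mul3 (- A) = mul3 A.
Proof. by rewrite /mul3 sqrrN. Qed.

(** The units $y$ and $y + A$ and their inverses $y^2 - A^2$ and
    $y^2 - A y$; the change of $A$ into $-A$ gives $y - A$ and its inverse. *)
Definition y3 : R * R * R := (0, 1, 0).
Definition yV3 A : R * R * R := (- A ^+ 2, 0, 1).
Definition yD3 A : R * R * R := (A, 1, 0).
Definition yDV3 A : R * R * R := (0, - A, 1).
Definition moves A := [:: y3; yV3 A; yD3 A; yDV3 A; yD3 (- A); yDV3 (- A)].

Lemma norm3_moves A b : b \in moves A -> norm3 A b = 1.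
Proof.
move=> hb; apply/eqP; move: b hb; apply/allP => /=; rewrite andbT.
by do ?[apply/andP; split]; apply/eqP; rewrite /norm3 /rem3 /value3 /=; ring.
Qed.

End Triples.

(** * Degrees at the infinite places *)

Section Sizes.

Variable F : fieldType.
Implicit Types (A p q : {poly F}) (a b : {poly F} * {poly F} * {poly F}).
Hypothesis F2 : 2%:R != 0 :> F.

Lemma size_add_leq n p q :
  (size p <= n)%N -> (size q <= n)%N -> (size (p + q)%R <= n)%N.
Proof. by move=> hp hq; rewrite (leq_trans (size_polyD _ _)) // geq_max hp. Qed.

Lemma size_sub_leq n p q :
  (size p <= n)%N -> (size q <= n)%N -> (size (p - q)%R <= n)%N.
Proof. by move=> hp hq; apply: size_add_leq; rewrite ?size_polyN. Qed.

Lemma size_mulf p q : p != 0 -> q != 0 -> size (p * q)%R = (size p + size q).-1.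
Proof. exact: size_mul. Qed.

Lemma size_cube A : A != 0 -> size (A ^+ 3)%R = (3 * (size A).-1).+1.
Proof.
move=> A0; rewrite exprS expr2 !size_mulf ?mulf_neq0 //.
by have := A0; rewrite -size_poly_gt0; lia.
Qed.

Lemma size_mulnc A p n : (1 < size A)%N ->
  (size (A * p)%R <= n)%N -> (size p <= n.-1)%N.
Proof.
move=> hA; have [->|p0] := eqVneq p 0; first by rewrite size_poly0.
have A0 : A != 0 by rewrite -size_poly_gt0; lia.
by rewrite size_mulf //; lia.
Qed.

Lemma size_double p : size (p *+ 2)%R = size p.
Proof. by rewrite -scaler_nat size_scale. Qed.

(** With $n = m + 1$, the maximum value of $a_0 + a_1 y + a_2 y^2$ is at most
    $m$; working with products avoids a special case for zero coefficients. *)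
Definition bounded3 A n a : bool :=
  let: (a0, a1, a2) := a in
  [&& (size a0 <= n)%N, (size (A * a1)%R <= n)%N & (size (A ^+ 2 * a2)%R <= n)%N].

Lemma bounded3N A n a : bounded3 (- A) n a = bounded3 A n a.
Proof. by case: a => -[a0 a1] a2; rewrite /bounded3 sqrrN mulNr size_polyN. Qed.

Lemma value3_leq A n a : bounded3 A n a -> (size (value3 A a) <= n)%N.
Proof.
by case: a => -[a0 a1] a2 /and3P[h0 h1 h2]; rewrite !size_add_leq.
Qed.

(** The coefficients and the three values determine each other linearly, with
    2 as the only denominator, so the maximum value is the largest degree at
    the three infinite places. *)
Lemma bounded3P A n a :
  bounded3 A n a =
  [&& (size (value3 A a) <= n)%N, (size (value3 (- A) a)%R <= n)%N
    & (size (value3 0 a) <= n)%N].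
Proof.
apply/idP/and3P => [h|].
  split; [exact: value3_leq|by rewrite value3_leq ?bounded3N|].
  case: a h => -[a0 a1] a2 /and3P[h0 _ _].
  by rewrite /= expr0n !mul0r !addr0.
case: a => -[a0 a1] a2 /= [h1 h2]; rewrite expr0n !mul0r !addr0 => h0.
have hX : (size (A * a1)%R <= n)%N.
  rewrite -size_double.
  have -> : (A * a1) *+ 2 = (a0 + A * a1 + A ^+ 2 * a2)
     - (a0 + - A * a1 + (- A) ^+ 2 * a2) by ring.
  exact: size_sub_leq.
rewrite h0 hX /=.
have -> : A ^+ 2 * a2 = (a0 + A * a1 + A ^+ 2 * a2) - a0 - A * a1 by ring.
by rewrite !size_sub_leq.
Qed.

Lemma size_mulA A p : (1 < size A)%N -> p != 0 ->
  size (A * p)%R = (size p + (size A).-1)%N.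
Proof.
move=> hA p0; have A0 : A != 0 by rewrite -size_poly_gt0; lia.
by rewrite size_mulf //; lia.
Qed.

Lemma size_cube_mul A p q r : A != 0 -> p != 0 -> q != 0 -> r != 0 ->
  (size (A ^+ 3 * (p * q * r))%R + 2 =
   3 * (size A).-1 + size p + size q + size r)%N.
Proof.
move=> A0 p0 q0 r0; have A3 : A ^+ 3 != 0 by rewrite expf_neq0.
rewrite (size_mulf A3) ?mulf_neq0 // size_cube // !size_mulf ?mulf_neq0 //.
by move: A0 p0 q0 r0; rewrite -!size_poly_gt0; lia.
Qed.

Lemma size_sqr_mul A p : (1 < size A)%N -> p != 0 ->
  size (A ^+ 2 * p)%R = (size p + 2 * (size A).-1)%N.
Proof.
move=> hA p0; have A0 : A != 0 by rewrite -size_poly_gt0; lia.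
rewrite expr2 !size_mulf ?mulf_neq0 //.
by have := p0; rewrite -size_poly_gt0; lia.
Qed.

Lemma size_mul_lt p q m n k : (size p <= m)%N -> (size q <= n)%N ->
  (m + n <= k.+1)%N -> (size (p * q)%R <= k)%N.
Proof. by move=> hp hq hk; have := size_polyMleq p q; lia. Qed.

(** Up to a factor $A^3$ and a term of low degree, the error is a cubic form in
    the three values each of whose monomials involves at least two of them. *)
Lemma rem3E A a :
  let: (a0, a1, a2) := a in
  A ^+ 3 * rem3 A a =
    A * a1 * (a0 * (a0 - A ^+ 2 * a2) - value3 A a * value3 (- A) a)
    + A * a2 * (A * a2 * (A * a2)).
Proof. by case: a => -[a0 a1] a2; rewrite /rem3 /value3; ring. Qed.

Lemma rem3_size A n a : (1 < size A)%N -> (size A <= n)%N ->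
  bounded3 A n.+1 a -> (size (A ^+ 3 * rem3 A a)%R <= 3 * n + 1)%N.
Proof.
move=> hA hn ha; have := ha; rewrite bounded3P => /and3P[v1 v2 _].
case: a ha v1 v2 (rem3E A a) => -[a0 a1] a2 /= /and3P[h0 h1 h2] v1 v2 ->.
have h2' : (size (A * a2)%R <= n)%N.
  by apply: (@size_mulnc A _ n.+1 hA); rewrite mulrA -expr2.
apply: size_add_leq.
  apply: (@size_mul_lt _ _ n.+1 (2 * n + 1)); [by []| |lia].
  apply: size_sub_leq; apply: (@size_mul_lt _ _ n.+1 n.+1); rewrite ?size_sub_leq //; lia.
apply: (@size_mul_lt _ _ n (2 * n)) => //; last lia.
by apply: (@size_mul_lt _ _ n n) => //; lia.
Qed.

(** When two of the values are not of maximal degree, the leading term of the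
    cubic form of [rem3E] vanishes. This gain of one degree makes the
    inequalities in [values3_size] strict. *)
Lemma rem3_size_lt A n a : (1 < size A)%N -> (size A <= n)%N ->
  bounded3 A n.+1 a ->
  [|| (size (value3 A a) <= n)%N && (size (value3 (- A) a)%R <= n)%N,
      (size (value3 A a) <= n)%N && (size (value3 0 a) <= n)%N
    | (size (value3 (- A) a)%R <= n)%N && (size (value3 0 a) <= n)%N] ->
  (size (A ^+ 3 * rem3 A a)%R <= 3 * n)%N.
Proof.
move=> hA hn ha; have := ha; rewrite bounded3P => /and3P[v1 v2 _].
case: a ha v1 v2 (rem3E A a) => -[a0 a1] a2 /= /and3P[h0 h1 h2] v1 v2 ->.
rewrite expr0n !mul0r !addr0 => hs.
have h2' : (size (A * a2)%R <= n)%N.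
  by apply: (@size_mulnc A _ n.+1 hA); rewrite mulrA -expr2.
apply: size_add_leq; last first.
  apply: (@size_mul_lt _ _ n (2 * n)) => //.
  by apply: (@size_mul_lt _ _ n n) => //; lia.
case/or3P: hs => /andP[s1 s2].
- apply: (@size_mul_lt _ _ n (2 * n + 1)); [| |lia].
    rewrite -size_double.
    have -> : (A * a1) *+ 2 = (a0 + A * a1 + A ^+ 2 * a2)
       - (a0 + - A * a1 + (- A) ^+ 2 * a2) by ring.
    exact: size_sub_leq.
  apply: size_sub_leq; apply: (@size_mul_lt _ _ n.+1 n.+1); rewrite ?size_sub_leq //; lia.
- apply: (@size_mul_lt _ _ n.+1 (2 * n)); [by []| |lia].
  apply: size_sub_leq; apply: (@size_mul_lt _ _ n n.+1); rewrite ?size_sub_leq //; lia.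
- apply: (@size_mul_lt _ _ n.+1 (2 * n)); [by []| |lia].
  apply: size_sub_leq.
    by apply: (@size_mul_lt _ _ n n.+1); rewrite ?size_sub_leq //; lia.
  by rewrite mulrC; apply: (@size_mul_lt _ _ n n.+1); rewrite ?size_sub_leq //; lia.
Qed.

(** An element of constant norm none of whose values is much smaller than the
    largest one has two rather small values. The degrees of the values add up
    to at most that of the error; a first, crude bound shows that two values are
    not of maximal degree, and then [rem3_size_lt] gives the sharp bound. *)
Lemma values3_size A n a : (1 < size A)%N -> (size A <= n)%N ->
  bounded3 A n.+1 a -> ~~ bounded3 A n a -> size (norm3 A a) = 1%N ->
  (n < size (A ^+ 2 * value3 A a)%R)%N ->
  (n < size (A ^+ 2 * value3 (- A) a)%R)%N ->
  (n < size (A ^+ 2 * value3 0 a)%R)%N ->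
  [|| (size (A * value3 (- A) a)%R <= n)%N && (size (A * value3 0 a)%R <= n)%N,
      (size (A * value3 A a)%R <= n)%N && (size (A * value3 0 a)%R <= n)%N
    | (size (A * value3 A a)%R <= n)%N && (size (A * value3 (- A) a)%R <= n)%N].
Proof.
move=> hA hn ha hna hN.
have A0 : A != 0 by rewrite -size_poly_gt0; lia.
have nz e : (n < size (A ^+ 2 * value3 e a)%R)%N ->
    (value3 e a != 0) /\ (n < size (value3 e a) + 2 * (size A).-1)%N.
  move=> h; have v0 : value3 e a != 0.
    by apply: contraTneq h => ->; rewrite mulr0 size_poly0.
  by rewrite -size_sqr_mul.
move=> /nz[nz1 b1] /nz[nz2 b2] /nz[nz3 b3].
have hR1 := @rem3_size A n a hA hn ha.
have hR2 := @rem3_size_lt A n a hA hn ha.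
move: ha hna; rewrite !bounded3P => /and3P[s1 s2 s3] hna.
have sA3 : size (A ^+ 3)%R = (3 * (size A).-1).+1 by exact: size_cube.
have sA e : value3 e a != 0 ->
    size (A * value3 e a)%R = (size (value3 e a) + (size A).-1)%N.
  exact: size_mulA.
rewrite !sA //.
have sprod_le k : (3 * (size A).-1 < k)%N -> (size (A ^+ 3 * rem3 A a)%R <= k)%N ->
   (3 * (size A).-1 + size (value3 A a) + size (value3 (- A) a)%R + size (value3 0 a) <= k + 2)%N.
  move=> hk hr.
  suff : (size (A ^+ 3 * (value3 A a * value3 (- A) a * value3 0 a))%R <= k)%N.
    by rewrite -(leq_add2r 2) size_cube_mul.
  have -> : A ^+ 3 * (value3 A a * value3 (- A) a * value3 0 a) =
     A ^+ 3 * norm3 A a - A ^+ 3 * rem3 A a by rewrite /norm3; ring.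
  apply: size_sub_leq => //.
  by apply: (@size_mul_lt _ _ (3 * (size A).-1).+1 1); rewrite ?sA3 ?hN; lia.
have {hR1} bnd1 := sprod_le (3 * n + 1)%N ltac:(lia) hR1.
have {hR2} bnd2 := sprod_le (3 * n)%N ltac:(lia) (hR2 _).
lia.
Qed.

(** The descent. A value small enough is compensated by the inverse of the
    unit which is small at the same place; otherwise [values3_size] applies and
    the unit which is small at the place of the largest value is used. *)
Lemma descent_step A n a : (1 < size A)%N -> (size A <= n)%N ->
  bounded3 A n.+1 a -> size (norm3 A a) = 1%N ->
  bounded3 A n a \/ exists2 b, b \in moves A & bounded3 A n (mul3 A b a).
Proof.
move=> hA hn ha hN.
have [hna|hna] := boolP (bounded3 A n a); [by left|right].
have hval := @values3_size A n a hA hn ha hna hN.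
have hv := ha; move: hv; rewrite bounded3P => /and3P[v1 v2 v3].
case: a {hN} ha hna hval v1 v2 v3 => -[a0 a1] a2 /and3P[h0 h1 h2] hna hval v1 v2 v3.
have h2' : (size (A * a2)%R <= n)%N.
  by apply: (@size_mulnc A _ n.+1 hA); rewrite mulrA -expr2.
have h1' : (size a1 <= n)%N by apply: (@size_mulnc A _ n.+1 hA).
have h2'' : (size a2 <= n)%N.
  by apply: leq_trans (@size_mulnc A _ n hA h2') _; lia.
have v0E : value3 0 (a0, a1, a2) = a0 by rewrite /= expr0n !mul0r !addr0.
rewrite v0E in hval v3.
have [s1|s1] := leqP (size (A ^+ 2 * value3 A (a0, a1, a2))%R) n.
  exists (yDV3 (- A)); first by rewrite !inE eqxx !orbT.
  have -> : mul3 A (yDV3 (- A)) (a0, a1, a2) =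
      (a1 + A * a2, a2 + A * value3 A (a0, a1, a2), value3 A (a0, a1, a2)).
    by congr (_, _, _); rewrite /value3; ring.
  by rewrite /bounded3 s1 mulrDr mulrA -expr2 !size_add_leq.
have [s2|s2] := leqP (size (A ^+ 2 * value3 (- A) (a0, a1, a2))%R) n.
  exists (yDV3 A); first by rewrite !inE eqxx !orbT.
  have -> : mul3 A (yDV3 A) (a0, a1, a2) =
      (a1 - A * a2, a2 - A * value3 (- A) (a0, a1, a2), value3 (- A) (a0, a1, a2)).
    by congr (_, _, _); rewrite /value3; ring.
  by rewrite /bounded3 s2 mulrBr mulrA -expr2 !size_sub_leq.
have [s3|s3] := leqP (size (A ^+ 2 * a0)%R) n.
  exists (yV3 A); first by rewrite !inE eqxx !orbT.
  have -> : mul3 A (yV3 A) (a0, a1, a2) = (a1 - A ^+ 2 * a0, a2, a0).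
    by congr (_, _, _); rewrite /value3; ring.
  by rewrite /bounded3 s3 h2' size_sub_leq.
case/or3P: (hval s1 s2 s3) => /andP[t1 t2].
- exists (yD3 (- A)); first by rewrite !inE eqxx !orbT.
  have -> : mul3 A (yD3 (- A)) (a0, a1, a2) =
     (a2 - A * a0, value3 (- A) (a0, a1, a2), a1 - A * a2).
    by congr (_, _, _); rewrite /value3; ring.
  rewrite /bounded3 t1 size_sub_leq //=.
  have -> : A ^+ 2 * (a1 - A * a2) = A * a0 - A * value3 (- A) (a0, a1, a2).
    by rewrite /value3; ring.
  exact: size_sub_leq.
- exists (yD3 A); first by rewrite !inE eqxx !orbT.
  have -> : mul3 A (yD3 A) (a0, a1, a2) =
     (a2 + A * a0, value3 A (a0, a1, a2), a1 + A * a2).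
    by congr (_, _, _); rewrite /value3; ring.
  rewrite /bounded3 t1 size_add_leq //=.
  have -> : A ^+ 2 * (a1 + A * a2) = A * value3 A (a0, a1, a2) - A * a0.
    by rewrite /value3; ring.
  exact: size_sub_leq.
- exists (y3 {poly F}); first by rewrite !inE eqxx.
  have -> : mul3 A (y3 {poly F}) (a0, a1, a2) = (a2, a0 + A ^+ 2 * a2, a1).
    by congr (_, _, _); rewrite /value3; ring.
  rewrite /bounded3 h2'' /=; apply/andP; split; rewrite -size_double.
    have -> : A * (a0 + A ^+ 2 * a2) *+ 2 = A * value3 A (a0, a1, a2)
       + A * value3 (- A) (a0, a1, a2) by rewrite /value3; ring.
    exact: size_add_leq.
  have -> : A ^+ 2 * a1 *+ 2 = A * value3 A (a0, a1, a2)
       - A * value3 (- A) (a0, a1, a2) by rewrite /value3; ring.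
  exact: size_sub_leq.
Qed.

(** With $a_2 = 0$ and $a_1 = c$ constant the norm is
    $a_0 (a_0 - c A) (a_0 + c A) + c^3$. If no factor vanishes, all are
    constants, and so is the difference $2 c A$ of two of them. *)
Lemma descent_base A a : (1 < size A)%N ->
  bounded3 A (size A) a -> size (norm3 A a) = 1%N ->
  exists2 c : F, c != 0 & a \in [:: (c%:P, 0, 0); (0, c%:P, 0);
     (c%:P * A, c%:P, 0); (- (c%:P * A), c%:P, 0)].
Proof.
case: a => -[a0 a1] a2 hA /and3P[h0 h1 h2].
have A0 : A != 0 by rewrite -size_poly_gt0; lia.
have a20 : a2 = 0.
  apply: contraTeq h2 => nz2; rewrite -ltnNge size_sqr_mul //.
  by move: nz2; rewrite -size_poly_gt0; lia.
rewrite {h2}a20.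
have /size1_polyC -> : (size a1 <= 1)%N.
  have [->|nz1] := eqVneq a1 0; first by rewrite size_poly0.
  by move: h1; rewrite size_mulf //; lia.
move: a1`_0 => c; clear h1.
have -> : norm3 A (a0, c%:P, 0) =
    (a0 + A * c%:P) * (a0 + - A * c%:P) * a0 + c%:P ^+ 3.
  by rewrite /norm3 /rem3 /value3; ring.
move=> hN.
have [c0|cn0] := eqVneq c 0.
  move: hN; rewrite c0 !mulr0 !addr0 expr0n addr0 => /eqP.
  rewrite !size_mul_eq1 !andbb => /size_poly1P[d d0 ->].
  by exists d => //; rewrite !inE eqxx.
exists c => //.
have hP : (size ((a0 + A * c%:P) * (a0 + - A * c%:P) * a0)%R <= 1)%N.
  have -> : (a0 + A * c%:P) * (a0 + - A * c%:P) * a0 =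
    ((a0 + A * c%:P) * (a0 + - A * c%:P) * a0 + c%:P ^+ 3) - (c ^+ 3)%:P.
    by rewrite polyC_exp addrK.
  by rewrite size_sub_leq ?size_polyC_leq1 ?hN.
have [->|n0] := eqVneq a0 0; first by rewrite !inE eqxx orbT.
have [/eqP|n1] := eqVneq (a0 + A * c%:P) 0.
  by rewrite addr_eq0 mulrC => /eqP->; rewrite !inE eqxx !orbT.
have [/eqP|n2] := eqVneq (a0 + - A * c%:P) 0.
  by rewrite addr_eq0 mulNr opprK mulrC => /eqP->; rewrite !inE eqxx !orbT.
have : size ((a0 + A * c%:P) * (a0 + - A * c%:P) * a0)%R == 1%N.
  by rewrite eqn_leq hP size_poly_gt0 !mulf_neq0.
rewrite !size_mul_eq1 => /andP[/andP[/eqP e1 /eqP e2] e0].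
have : (size (A * c%:P)%R <= 1)%N.
  rewrite -size_double.
  have -> : A * c%:P *+ 2 = (a0 + A * c%:P) - (a0 + - A * c%:P) by ring.
  by rewrite size_sub_leq ?e1 ?e2.
by rewrite mulrC size_Cmul // leqNgt hA.
Qed.

(** Up to the common bound $k deg A$ on the three degrees, $a$ is as large as
    possible at the place where $y$ is close to $A$. This property is
    multiplicative enough to replace the valuation of that place. *)
Definition leading3 A k a : bool :=
  bounded3 A (k * (size A).-1).+1 a &&
  (size (value3 A a) == (k * (size A).-1).+1).

Lemma leading3_1 A : leading3 A 0 (1, 0, 0).
Proof.
by rewrite /leading3 /bounded3 /value3 !mulr0 !addr0 size_poly1 size_poly0.
Qed.

Lemma leading3_lower A k (a0 a1 a2 : {poly F}) : (1 < size A)%N ->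
  bounded3 A (k * (size A).-1).+1 (a0, a1, a2) ->
  [/\ (size a2 <= k * (size A).-1)%N, (size (A * a2)%R <= k * (size A).-1)%N,
     (size a1 <= k * (size A).-1)%N,
     (size (A ^+ 2 * a1)%R <= (k.+1 * (size A).-1).+1)%N
   & forall p, (size p <= (k * (size A).-1).+1)%N ->
       (size (A * p)%R <= (k.+1 * (size A).-1).+1)%N].
Proof.
move=> hA /and3P[h0 h1 h2].
have hmul p : (size p <= (k * (size A).-1).+1)%N ->
    (size (A * p)%R <= (k.+1 * (size A).-1).+1)%N.
  by move=> hp; apply: (size_mul_lt (leqnn _) hp); rewrite mulSn; lia.
have h2' : (size (A * a2)%R <= k * (size A).-1)%N.
  by apply: (@size_mulnc A _ (k * (size A).-1).+1 hA); rewrite mulrA -expr2.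
split=> //; first by apply: leq_trans (size_mulnc hA h2') (leq_pred _).
  by apply: (@size_mulnc A _ (k * (size A).-1).+1 hA).
by rewrite expr2 -mulrA; apply: hmul.
Qed.

Lemma size_lead A k p q : (1 < size A)%N ->
  (size q <= k * (size A).-1)%N -> size p = (k * (size A).-1).+1 ->
  size (q + A * p)%R = (k.+1 * (size A).-1).+1.
Proof.
move=> hA hq hp.
have A0 : A != 0 by rewrite -size_poly_gt0; lia.
have p0 : p != 0 by rewrite -size_poly_gt0 hp.
have e : size (A * p)%R = (k.+1 * (size A).-1).+1.
  by rewrite size_mulf // hp mulSn; lia.
by rewrite addrC size_polyDl // e; lia.
Qed.

Lemma leading3_y A k a : (1 < size A)%N ->
  leading3 A k a -> leading3 A k.+1 (mul3 A (y3 {poly F}) a).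
Proof.
case: a => -[a0 a1] a2 hA /andP[hb /eqP hv].
have [l1 l2 l3 l4 l5] := leading3_lower hA hb.
have hb' := hb; move/and3P: hb' => [h0 h1 h2].
rewrite /leading3.
have -> : mul3 A (y3 {poly F}) (a0, a1, a2) = (a2, a0 + A ^+ 2 * a2, a1).
  by congr (_, _, _); ring.
have -> : value3 A (a2, a0 + A ^+ 2 * a2, a1) = a2 + A * value3 A (a0, a1, a2).
  by rewrite /value3; ring.
rewrite (size_lead hA _ hv) // eqxx andbT /bounded3 l4 l5 ?size_add_leq //.
by rewrite !andbT (leq_trans l1) // mulSn; lia.
Qed.

(** At the other large place, where $y$ is close to $-A$, multiplication by
    $y + A$ loses the leading term. *)
Lemma leading3_yD A k a : (1 < size A)%N ->
  leading3 A k a -> leading3 A k.+1 (mul3 A (yD3 A) a) /\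
    (size (value3 (- A) (mul3 A (yD3 A) a))%R <= k * (size A).-1)%N.
Proof.
case: a => -[a0 a1] a2 hA /andP[hb /eqP hv].
have [l1 l2 l3 l4 l5] := leading3_lower hA hb.
have hb' := hb; move/and3P: hb' => [h0 h1 h2].
rewrite /leading3.
have -> : mul3 A (yD3 A) (a0, a1, a2) =
    (a2 + A * a0, value3 A (a0, a1, a2), a1 + A * a2).
  by congr (_, _, _); rewrite /value3; ring.
have -> : value3 A (a2 + A * a0, value3 A (a0, a1, a2), a1 + A * a2) =
    a2 + A * (value3 A (a0, a1, a2) *+ 2).
  by rewrite /value3; ring.
have -> : value3 (- A) (a2 + A * a0, value3 A (a0, a1, a2), a1 + A * a2) = a2.
  by rewrite /value3; ring.
split=> //.
have lk : (k * (size A).-1 <= (k.+1 * (size A).-1).+1)%N by rewrite mulSn; lia.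
rewrite (size_lead hA l1) ?size_double // eqxx andbT /bounded3 l5 ?hv //.
have -> : A ^+ 2 * (a1 + A * a2) = A ^+ 2 * a1 + A * (A ^+ 2 * a2) by ring.
by rewrite !size_add_leq ?l5 // (leq_trans l1).
Qed.

End Sizes.

(** * Integral rational functions *)

Lemma clear_denominator (K : fieldType) (c n d : K) k i : (i <= k)%N -> d != 0 ->
  d ^+ k * (c * (n / d) ^+ i) = c * n ^+ i * d ^+ (k - i).
Proof.
move=> ik d0; rewrite expr_div_n -{1}(subnK ik) exprD.
have : d ^+ i != 0 by rewrite expf_neq0.
by move=> di0; field.
Qed.

Section Frac.
Variable F : fieldType.
Local Notation tofracF := (@tofrac {poly F}).

Lemma frac_quotient (R : idomainType) (x : {fraction R}) :
  exists2 nd : R * R, nd.2 != 0 & x = tofrac nd.1 / tofrac nd.2.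
Proof.
suff [nd d0 xd] : exists2 nd : R * R, nd.2 != 0 & x * tofrac nd.2 = tofrac nd.1.
  by exists nd; rewrite // -xd mulfK // tofrac_eq0.
elim/quotW: x => r; exists (frac r); first exact: denom_ratioP.
rewrite -[LHS]/(FracField.mul _ _) !piE.
apply/eqmodP; rewrite /= FracField.equivfE.
by rewrite !numden_Ratio ?mulf_neq0 ?denom_ratioP ?oner_eq0 //= !mulr1 mulrC.
Qed.

Lemma frac_reduced (x : {fraction {poly F}}) :
  exists nd : {poly F} * {poly F},
    [/\ nd.2 != 0, coprimep nd.1 nd.2 & x = tofrac nd.1 / tofrac nd.2].
Proof.
have [[n d] /= d0 ->] := frac_quotient x.
have g0 : gcdp n d != 0 by rewrite gcdp_eq0 negb_and d0 orbT.
exists (n %/ gcdp n d, d %/ gcdp n d) => /=; split.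
- by rewrite divpN0 // leq_gcdpr.
- by rewrite coprimep_div_gcd // d0 orbT.
have g0' : tofracF (gcdp n d) != 0 by rewrite tofrac_eq0.
rewrite -{1}(divpK (dvdp_gcdl n d)) -[in X in _ / X](divpK (dvdp_gcdr n d)).
by rewrite !rmorphM /= invfM mulrACA divff ?mulr1.
Qed.

(** The rational root theorem: clearing denominators in a monic equation of
    $n / d$ shows that $d$ divides a power of $n$. *)
Lemma integral_frac (x : {fraction {poly F}}) :
  integralOver tofracF x -> exists p, x = tofrac p.
Proof.
have [[n d] /= [d0 cop ->]] := frac_reduced x; set x' := _ / _.
case=> p mon_p; rewrite /root horner_coef size_map_poly_id0; last first.
  by rewrite tofrac_eq0 (monicP mon_p) oner_eq0.
have d0' : tofracF d != 0 by rewrite tofrac_eq0.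
have p0 : (0 < size p)%N by rewrite size_poly_gt0 monic_neq0.
case sp: (size p) p0 => [//|k] _.
have x'E (i : 'I_k.+1) : tofracF d ^+ k * ((map_poly tofracF p)`_i * x' ^+ i) =
    tofrac (p`_i * n ^+ i * d ^+ (k - i)).
  by rewrite coef_map !rmorphM !rmorphXn clear_denominator // -ltnS.
move=> /eqP /(congr1 ( *%R (tofracF d ^+ k))); rewrite mulr0 mulr_sumr.
under eq_bigr do rewrite x'E.
rewrite -rmorph_sum /= => /eqP; rewrite tofrac_eq0 big_ord_recr /=.
have -> : p`_k = 1 by have := monicP mon_p; rewrite /lead_coef sp.
rewrite subnn expr0 mulr1 mul1r addrC addr_eq0 => /eqP hn.
have dvdn : d %| n ^+ k.
  rewrite hn dvdpNr; apply: (big_ind (fun q => d %| q)) => [|u v|i _].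
  - exact: dvdp0.
  - exact: dvdp_add.
  by rewrite -(subnSK (ltn_ord i)) exprS mulrCA dvdp_mulr // dvdpp.
have cop' : coprimep d (n ^+ k) by rewrite coprimep_sym coprimep_expl.
have /size_poly1P[c c0 dE] : size d == 1%N by rewrite -dvdp1 -(Gauss_dvdpr 1 cop') mulr1.
exists (c^-1 *: n); rewrite /x' dE.
have -> : tofracF n = tofrac (c%:P * (c^-1 *: n)).
  by rewrite mul_polyC scalerA divff // scale1r.
have c0' : tofracF c%:P != 0 by rewrite tofrac_eq0 polyC_eq0.
by rewrite rmorphM [X in X / _]mulrC mulfK.
Qed.

(** If $D (n/d)^2$ is a polynomial with $n$ and $d$ coprime, then $d^2$ divides
    $D$. *)
Lemma squarefree_frac (D : {poly F}) (x : {fraction {poly F}}) :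
  (forall u : {poly F}, size u != 1%N -> ~~ (u ^+ 2 %| D)) ->
  integralOver tofracF (tofrac D * x ^+ 2) -> exists p, x = tofrac p.
Proof.
move=> sqf /integral_frac[q].
have [[n d] /= [d0 cop ->]] := frac_reduced x.
have d0' : tofracF d != 0 by rewrite tofrac_eq0.
move=> /(congr1 ( *%R^~ (tofracF d ^+ 2))).
have -> : tofracF D * (tofracF n / tofracF d) ^+ 2 * tofracF d ^+ 2 =
  tofracF (D * n ^+ 2).
  by rewrite mulrC clear_denominator // subnn mulr1 rmorphM rmorphXn.
rewrite -rmorphXn -rmorphM /= => /eqP; rewrite tofrac_eq => /eqP hq.
have : d ^+ 2 %| D.
  have cop' : coprimep (d ^+ 2) (n ^+ 2).
    by rewrite coprimep_expl // coprimep_expr // coprimep_sym.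
  by rewrite -(Gauss_dvdpl D cop') hq dvdp_mulIr.
move=> hdvd; have /size_poly1P[c c0 ->] : size d == 1%N.
  by apply: contraTT hdvd; exact: sqf.
exists (c^-1 *: n).
have -> : tofracF n = tofrac (c%:P * (c^-1 *: n)).
  by rewrite mul_polyC scalerA divff // scale1r.
have c0' : tofracF c%:P != 0 by rewrite tofrac_eq0 polyC_eq0.
by rewrite rmorphM [X in X / _]mulrC mulfK.
Qed.

End Frac.

(** * The integral basis *)

HB.instance Definition _ (F : finFieldType) (L : fieldExtType {fraction {poly F}}) :=
  GRing.RMorphism.copy (@emb F L) (in_alg L \o @tofrac {poly F}).

Section Order.
Variables (F : finFieldType) (L : fieldExtType {fraction {poly F}}).
Variables (y : L) (A : {poly F}).
Hypothesis F2 : 2%:R != 0 :> F.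
Hypothesis hL : <<1%VS; y>>%VS = fullv.
Hypothesis hy : y ^+ 3 = emb L A ^+ 2 * y + 1.
Hypothesis hA : (1 < size A)%N.
Local Notation K := {fraction {poly F}}.
Local Notation tofracF := (@tofrac {poly F}).

Lemma emb_inj : injective (emb L).
Proof. by move=> p q /(fmorph_inj (in_alg L))/eqP; rewrite tofrac_eq => /eqP. Qed.

Lemma integral_cubic_root (E : nzRingType) (h : {rmorphism {poly F} -> E}) z :
  z ^+ 3 = h A ^+ 2 * z + 1 -> integralOver h z.
Proof.
move=> hz; exists ('X^3 - (A ^+ 2 *: 'X + 1)).
  rewrite monicE lead_coefDl ?lead_coefXn // size_polyN size_polyXn.
  rewrite (leq_ltn_trans (size_polyD _ _)) // gtn_max size_poly1 andbT.
  by rewrite (leq_ltn_trans (size_scale_leq _ _)) // size_polyX.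
rewrite /root rmorphB rmorphD /= map_polyZ map_polyXn map_polyX rmorphXn rmorph1 /=.
by rewrite hornerD hornerN hornerD hornerZ hornerXn hornerX hornerC subr_eq0 hz.
Qed.

Definition cubic : {poly K} := 'X^3 - (tofracF A ^+ 2 *: 'X + 1).

Lemma size_cubic : size cubic = 4%N.
Proof.
rewrite size_polyDl size_polyXn // size_polyN.
rewrite (leq_ltn_trans (size_polyD _ _)) // gtn_max size_poly1 andbT.
by rewrite (leq_ltn_trans (size_scale_leq _ _)) // size_polyX.
Qed.

Lemma cubic_root (E : fieldType) (j : {rmorphism K -> E}) z :
  root (map_poly j cubic) z = (z ^+ 3 == j (tofrac A) ^+ 2 * z + 1).
Proof.
rewrite /root rmorphB rmorphD /= map_polyZ map_polyXn map_polyX rmorphXn rmorph1 /=.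
by rewrite !hornerE subr_eq0.
Qed.

(** A rational root is a polynomial $p$ with $p (p - A) (p + A) = 1$, which
    would make $2 A$ a constant. *)
Lemma cubic_irr : irreducible_poly cubic.
Proof.
apply: cubic_irreducible; rewrite ?size_cubic // => x; apply/negP => rx.
have := @cubic_root K idfun x.
rewrite map_poly_id // rx => /esym/eqP /= hx.
have [p xE] : exists p, x = tofrac p.
  by apply: integral_frac; apply: (@integral_cubic_root _ tofracF).
move: hx; rewrite xE -!rmorphXn -rmorphM -(rmorph1 tofracF) -rmorphD /=.
move=> /eqP; rewrite tofrac_eq => /eqP hp.
have : size (p * ((p - A) * (p + A))) == 1%N.
  rewrite [p * _](_ : _ = 1) ?size_poly1 //.
  rewrite -[RHS](addrK (A ^+ 2 * p)) [1 + _]addrC -hp; ring.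
rewrite !size_mul_eq1 => /andP[_ /andP[/eqP e1 /eqP e2]].
have : (size A <= 1)%N.
  rewrite -(size_double F2) [A *+ 2](_ : _ = (p + A) - (p - A)); last by ring.
  by rewrite size_sub_leq ?e1 ?e2.
by rewrite leqNgt hA.
Qed.

Lemma cubic_dvd g : (map_poly (in_alg L) g).[y] = 0 -> cubic %| g.
Proof.
move=> gy; case: (boolP (cubic %| g)) => // hn.
have [_ irr] := cubic_irr.
have /Bezout_eq1_coprimepP[[u v] /= huv] : coprimep cubic g.
  have [//|ncop] := boolP (coprimep cubic g).
  have /eqp_dvdl h := irr _ ncop (dvdp_gcdl _ _).
  by rewrite -h dvdp_gcdr in hn.
have : (map_poly (in_alg L) (u * cubic + v * g)).[y] = 1.
  by rewrite huv rmorph1 hornerC.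
rewrite rmorphD !rmorphM /= hornerD !hornerM gy mulr0 addr0.
have /rootP -> : root (map_poly (in_alg L) cubic) y by rewrite cubic_root hy.
by rewrite mulr0 => /eqP; rewrite eq_sym oner_eq0.
Qed.

Lemma coords u : exists b0 b1 b2 : K, u = b0%:A + b1%:A * y + b2%:A * y ^+ 2.
Proof.
have : u \in <<1%VS; y>>%VS by rewrite hL memvf.
case/Fadjoin_polyP => p /polyOver1P[q ->] ->.
have c0 : cubic != 0 by rewrite -size_poly_gt0 size_cubic.
rewrite [q](divp_eq q cubic) rmorphD rmorphM /= hornerD hornerM.
have /rootP -> : root (map_poly (in_alg L) cubic) y by rewrite cubic_root hy.
rewrite mulr0 add0r.
have hs : (size (q %% cubic)%R <= 3)%N by rewrite -ltnS -size_cubic ltn_modp.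
move: (q %% cubic) hs => r hs.
rewrite (@horner_coef_wide _ 3) ?size_map_poly //.
rewrite !big_ord_recr big_ord0 /= !coef_map /= expr0 expr1 mulr1 add0r.
by exists r`_0, r`_1, r`_2.
Qed.

Definition elt3 (a : {poly F} * {poly F} * {poly F}) : L :=
  let: (a0, a1, a2) := a in emb L a0 + emb L a1 * y + emb L a2 * y ^+ 2.

Lemma elt3M a b : elt3 (mul3 A a b) = elt3 a * elt3 b.
Proof.
case: a => -[a0 a1] a2; case: b => -[b0 b1] b2.
rewrite /elt3 /mul3 !(rmorphD, rmorphM, rmorphXn) /=.
have y4 : y ^+ 4 = emb L A ^+ 2 * y ^+ 2 + y by rewrite exprS hy; ring.
have -> : (emb L a0 + emb L a1 * y + emb L a2 * y ^+ 2) *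
 (emb L b0 + emb L b1 * y + emb L b2 * y ^+ 2) =
  emb L a0 * emb L b0 + (emb L a0 * emb L b1 + emb L a1 * emb L b0) * y
  + (emb L a0 * emb L b2 + emb L a1 * emb L b1 + emb L a2 * emb L b0) * y ^+ 2
  + (emb L a1 * emb L b2 + emb L a2 * emb L b1) * y ^+ 3
  + emb L a2 * emb L b2 * y ^+ 4 by ring.
by rewrite y4 hy; ring.
Qed.

Lemma elt3_inj : injective elt3.
Proof.
move=> [[a0 a1] a2] [[b0 b1] b2] /eqP; rewrite -subr_eq0 /elt3 => /eqP h.
pose g := \poly_(i < 3) tofracF [:: a0 - b0; a1 - b1; a2 - b2]`_i.
have hg : (map_poly (in_alg L) g).[y] = 0.
  rewrite (@horner_coef_wide _ 3); last by rewrite size_map_poly size_poly.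
  rewrite !big_ord_recr big_ord0 /= !coef_map !coef_poly /= add0r -h.
  rewrite -!/(emb L _) !rmorphB /=; ring.
have g0 : g = 0.
  apply/eqP; apply: contraTT (cubic_dvd hg) => gn0.
  by rewrite gtNdvdp // size_cubic ltnS size_poly.
have gi i : (i < 3)%N -> [:: a0 - b0; a1 - b1; a2 - b2]`_i = 0.
  move=> hi; apply/eqP; rewrite -tofrac_eq0.
  by move/polyP/(_ i): g0; rewrite coef_poly hi coef0 => ->.
congr (_, _, _); apply/eqP; rewrite -subr_eq0; apply/eqP.
- exact: (gi 0%N).
- exact: (gi 1%N).
- exact: (gi 2%N).
Qed.

(** For $c_1 = y$ and $c_0 = y^2 - A^2$ this yields the other two conjugates
    $z$ and $- y - z$ of $y$. *)
Lemma quadratic_ext (c1 c0 : L) : exists (E : fieldType) (iota : {rmorphism L -> E}) z,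
  z ^+ 2 + iota c1 * z + iota c0 = 0.
Proof.
pose q : {poly L} := 'X^2 + (c1 *: 'X + c0%:P).
have sq : size q = 3%N.
  rewrite size_polyDl size_polyXn // (leq_ltn_trans (size_polyD _ _)) //.
  rewrite gtn_max (leq_ltn_trans (size_polyC_leq1 _)) // andbT.
  by rewrite (leq_ltn_trans (size_scale_leq _ _)) // size_polyX.
have rq (E : fieldType) (iota : {rmorphism L -> E}) z :
   root (map_poly iota q) z -> z ^+ 2 + iota c1 * z + iota c0 = 0.
  rewrite /root !rmorphD /= map_polyZ map_polyXn map_polyX map_polyC /=.
  by rewrite !hornerE => /eqP.
have [[z rz]|nr] := classic (exists z, root q z).
  by exists L, idfun, z; apply: rq; rewrite map_poly_id.
have irr : irreducible_poly q.
  by apply: cubic_irreducible; rewrite ?sq // => z; apply/negP => rz; case: nr; exists z.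
have [E _ [z rz _]] := irredp_FAdjoin irr.
by exists E, (in_alg E), z; apply: rq.
Qed.

(** Integrality passes to conjugates: inserting $g(Y)$ into a monic equation of
    $g(y)$ gives a multiple of the cubic, which vanishes at its other roots. *)
Lemma integral_conj (E : fieldType) (iota : {rmorphism L -> E}) (g : {poly K}) z :
  z ^+ 3 = iota (emb L A) ^+ 2 * z + 1 ->
  in_order (map_poly (in_alg L) g).[y] ->
  integralOver (iota \o emb L) (map_poly (iota \o in_alg L) g).[z].
Proof.
move=> hz [p mon_p rp]; exists p => //.
have hcomp : map_poly (in_alg L) (map_poly tofracF p \Po g) =
    map_poly (emb L) p \Po map_poly (in_alg L) g.
  by rewrite map_comp_poly -map_poly_comp.
have : cubic %| map_poly tofracF p \Po g.
  by apply: cubic_dvd; rewrite hcomp horner_comp; apply/rootP.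
case/dvdpP => r /(congr1 (map_poly (iota \o in_alg L))).
rewrite rmorphM map_comp_poly -map_poly_comp /= => /(congr1 (horner^~ z)).
rewrite hornerM horner_comp.
have /rootP -> : root (map_poly (iota \o in_alg L) cubic) z by rewrite cubic_root hz.
by rewrite mulr0 => /rootP.
Qed.

(** The discriminant of $Y^3 - a Y - 1$, whose roots are $y_1$, $z$ and
    $- y_1 - z$. *)
Lemma vandermonde_disc (E : comNzRingType) (a y1 z : E) :
  y1 ^+ 3 = a * y1 + 1 -> z ^+ 2 + y1 * z + (y1 ^+ 2 - a) = 0 ->
  ((y1 - z) * (y1 - (- y1 - z)) * (z - (- y1 - z))) ^+ 2 = 4%:R * a ^+ 3 - 27%:R.
Proof.
move=> h1 h2.
(* Both a and 1 are symmetric polynomials in the roots. *)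
have aE : a = z ^+ 2 + y1 * z + y1 ^+ 2.
  by rewrite -[LHS]add0r -h2; ring.
have oneE : 1 = - (y1 * z * (y1 + z)) :> E.
  have -> : 1 = y1 ^+ 3 - a * y1 by rewrite h1 addrC addKr.
  by rewrite aE; ring.
have sq1 : (y1 * z * (y1 + z)) ^+ 2 = 1 by rewrite -sqrrN -oneE expr1n.
have -> : 27%:R = 27%:R * (y1 * z * (y1 + z)) ^+ 2 by rewrite sq1 mulr1.
by rewrite aE; ring.
Qed.

(** By Cramer's rule, applied to the conjugates of $u$, each coefficient of $u$
    times the Vandermonde product $V$ of the conjugates of $y$ is integral, and
    $V^2 = D$. *)
Lemma integral_basis u : squarefree (4%:R *: A ^+ 6 - 27%:R%:P) -> in_order u ->
  exists a, u = elt3 a.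
Proof.
move=> hD hu; have [b0 [b1 [b2 uE]]] := coords u.
have [E [iota [z hz]]] := quadratic_ext y (y ^+ 2 - emb L A ^+ 2).
rewrite rmorphB !rmorphXn /= in hz.
set y1 := iota y in hz; set a := iota (emb L A) in hz.
have h1 : y1 ^+ 3 = a ^+ 2 * y1 + 1.
  by rewrite -rmorphXn hy rmorphD rmorphM rmorphXn rmorph1.
have aE : a ^+ 2 = z ^+ 2 + y1 * z + y1 ^+ 2 by rewrite -[LHS]add0r -hz; ring.
have h2 : z ^+ 3 = a ^+ 2 * z + 1.
  have -> : 1 = y1 ^+ 3 - a ^+ 2 * y1 by rewrite h1 addrC addKr.
  by rewrite aE; ring.
pose w := - y1 - z.
have h3 : w ^+ 3 = a ^+ 2 * w + 1.
  have -> : 1 = y1 ^+ 3 - a ^+ 2 * y1 by rewrite h1 addrC addKr.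
  by rewrite aE /w; ring.
pose V := (y1 - z) * (y1 - w) * (z - w).
have V2 : V ^+ 2 = iota (emb L (4%:R *: A ^+ 6 - 27%:R%:P)).
  rewrite /V (vandermonde_disc h1 hz) -mul_polyC !(rmorphB, rmorphM, rmorphXn) /=.
  by rewrite -exprM !(polyC_natr, rmorph_nat).
pose j : {rmorphism K -> E} := iota \o in_alg L.
pose g : {poly K} := \poly_(i < 3) [:: b0; b1; b2]`_i.
have gE (E' : fieldType) (h : {rmorphism K -> E'}) x :
    (map_poly h g).[x] = h b0 + h b1 * x + h b2 * x ^+ 2.
  rewrite (@horner_coef_wide _ 3); last by rewrite size_map_poly size_poly.
  by rewrite !big_ord_recr big_ord0 /= !coef_map !coef_poly /= add0r mulr1.
have int_g x : x ^+ 3 = a ^+ 2 * x + 1 ->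
    integralOver (iota \o emb L) (j b0 + j b1 * x + j b2 * x ^+ 2).
  by move=> hx; rewrite -gE; apply: integral_conj => //; rewrite gE -uE.
have int_root x : x ^+ 3 = a ^+ 2 * x + 1 -> integralOver (iota \o emb L) x.
  exact: (@integral_cubic_root E (iota \o emb L)).
have coef_poly b : integralOver (iota \o emb L) (j b * V) -> exists p, b = tofrac p.
  move=> hb; apply: (squarefree_frac hD).
  have : integralOver (iota \o emb L) (j (tofrac (4%:R *: A ^+ 6 - 27%:R%:P) * b ^+ 2)).
    have -> : j (tofrac (4%:R *: A ^+ 6 - 27%:R%:P) * b ^+ 2) = (j b * V) * (j b * V).
      by rewrite rmorphM rmorphXn -[(j b * V) * _]expr2 exprMn V2 mulrC.
    exact: integral_mul.
  case=> p mon_p rp; exists p => //; rewrite -(fmorph_root j).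
  by rewrite -map_poly_comp.
have i1 := int_g _ h1; have i2 := int_g _ h2; have i3 := int_g _ h3.
have r1 := int_root _ h1; have r2 := int_root _ h2; have r3 := int_root _ h3.
move: i1 i2 i3.
set u1 := j b0 + j b1 * y1 + _; set u2 := j b0 + j b1 * z + _.
set u3 := j b0 + j b1 * w + _.
move=> i1 i2 i3.
have intM := @integral_mul _ _ (iota \o emb L).
have intB := @integral_sub _ _ (iota \o emb L).
have intD := @integral_add _ _ (iota \o emb L).
have comb q1 q2 q3 : integralOver (iota \o emb L) q1 ->
    integralOver (iota \o emb L) q2 -> integralOver (iota \o emb L) q3 ->
    integralOver (iota \o emb L) (u1 * q1 + u2 * q2 + u3 * q3).
  move=> k1 k2 k3; apply: (intD _ _ _ (intM _ _ i3 k3)).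
  exact: (intD _ _ (intM _ _ i1 k1) (intM _ _ i2 k2)).
have [a2 b2E] : exists p, b2 = tofrac p.
  apply: coef_poly.
  have -> : j b2 * V = u1 * (z - w) + u2 * (w - y1) + u3 * (y1 - z).
    by rewrite /u1 /u2 /u3 /V; ring.
  by apply: comb; apply: intB.
have [a1 b1E] : exists p, b1 = tofrac p.
  apply: coef_poly.
  have -> : j b1 * V = u1 * (w * w - z * z) + u2 * (y1 * y1 - w * w)
      + u3 * (z * z - y1 * y1).
    by rewrite /u1 /u2 /u3 /V; ring.
  by apply: comb; apply: intB; apply: intM.
have [a0 b0E] : exists p, b0 = tofrac p.
  apply: coef_poly.
  have -> : j b0 * V = u1 * (z * w * (z - w)) + u2 * (w * y1 * (w - y1))
      + u3 * (y1 * z * (y1 - z)).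
    by rewrite /u1 /u2 /u3 /V; ring.
  apply: comb; first exact: (intM _ _ (intM _ _ r2 r3) (intB _ _ r2 r3)).
    exact: (intM _ _ (intM _ _ r3 r1) (intB _ _ r3 r1)).
  exact: (intM _ _ (intM _ _ r1 r2) (intB _ _ r1 r2)).
by exists (a0, a1, a2); rewrite uE b0E b1E b2E.
Qed.

End Order.

(** * Generation and independence *)

Section Units.
Variables (F : finFieldType) (L : fieldExtType {fraction {poly F}}).
Variables (y : L) (A : {poly F}).
Hypothesis F2 : 2%:R != 0 :> F.
Hypothesis hL : <<1%VS; y>>%VS = fullv.
Hypothesis hy : y ^+ 3 = emb L A ^+ 2 * y + 1.
Hypothesis hA : (1 < size A)%N.

Local Notation yA := (emb L A + y).
Local Notation elt3 := (elt3 y).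

Lemma y_relation : y * (y - emb L A) * yA = 1.
Proof.
have -> : y * (y - emb L A) * yA = y ^+ 3 - emb L A ^+ 2 * y by ring.
by rewrite hy addrC addKr.
Qed.

Lemma y_neq0 : y != 0.
Proof. by apply: contra_eq_neq y_relation => ->; rewrite !mul0r eq_sym oner_eq0. Qed.

Lemma yA_neq0 : yA != 0.
Proof. by apply: contra_eq_neq y_relation => ->; rewrite !mulr0 eq_sym oner_eq0. Qed.

Lemma elt3_moves b : b \in moves A -> exists i j : int, elt3 b = y ^ i * yA ^ j.
Proof.
have y0 := y_neq0; have yA0 := yA_neq0.
have rel := y_relation.
have yV : y^-1 = (y - emb L A) * yA.
  by apply: (mulfI y0); rewrite mulfV // mulrA rel.
have yAV : yA^-1 = y * (y - emb L A).
  by apply: (mulIf yA0); rewrite mulVf // rel.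
have elt3E a0 a1 a2 : elt3 (a0, a1, a2) = emb L a0 + emb L a1 * y + emb L a2 * y ^+ 2 by [].
rewrite !inE => /or4P[|||/or3P[]] /eqP->; rewrite elt3E ?rmorph0 ?rmorph1 ?rmorphN ?rmorphXn.
- by exists 1, 0; rewrite expr1z expr0z; ring.
- by exists (-1), 0; rewrite exprN1 expr0z yV; ring.
- by exists 0, 1; rewrite expr1z expr0z; ring.
- by exists 0, (-1); rewrite exprN1 expr0z yAV; ring.
- exists (-1), (-1); rewrite !exprN1 yV yAV.
  have -> : (y - emb L A) * yA * (y * (y - emb L A)) =
    (y * (y - emb L A) * yA) * (y - emb L A) by ring.
  by rewrite rel; ring.
- by exists 1, 1; rewrite !expr1z; ring.
Qed.

Lemma elt3_const p : elt3 (p, 0, 0) = emb L p.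
Proof. by rewrite /elt3 !rmorph0 !mul0r !addr0. Qed.

Lemma norm3_unit a : order_unit (elt3 a) ->
  squarefree (4%:R *: A ^+ 6 - 27%:R%:P) -> size (norm3 A a) = 1%N.
Proof.
case=> _ [w hw hmul] hD.
have [b wE] := integral_basis F2 hL hy hA hD hw.
have hone : mul3 A a b = (1, 0, 0).
  by apply: (elt3_inj F2 hy hA); rewrite (elt3M hy) -wE hmul elt3_const rmorph1.
apply/eqP; suff : size (norm3 A a * norm3 A b) == 1%N.
  by rewrite size_mul_eq1 => /andP[].
rewrite -norm3M hone [norm3 _ _](_ : _ = 1) ?size_poly1 //.
by rewrite /norm3 /rem3 /value3; ring.
Qed.

Lemma bounded3W m n a : (m <= n)%N -> bounded3 A m a -> bounded3 A n a.
Proof.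
case: a => -[a0 a1] a2 mn /and3P[h0 h1 h2].
by rewrite /bounded3 (leq_trans h0) ?(leq_trans h1) ?(leq_trans h2).
Qed.

(** A descent on the maximum value, which replaces $alpha$ by its product with
    one of the units of [moves] until [descent_base] applies. *)
Lemma norm1_generated n a : bounded3 A n a -> size (norm3 A a) = 1%N ->
  exists c : F, exists i j : int, c != 0 /\ elt3 a = emb L c%:P * (y ^ i * yA ^ j).
Proof.
have y0 := y_neq0; have yA0 := yA_neq0.
have base a' : bounded3 A (size A) a' -> size (norm3 A a') = 1%N ->
  exists c : F, exists i j : int, c != 0 /\ elt3 a' = emb L c%:P * (y ^ i * yA ^ j).
  move=> hb hN; have [c c0 ha] := descent_base F2 hA hb hN.
  exists c.
  have scale b : b \in (1, 0, 0) :: moves A ->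
      exists i j : int, elt3 b = y ^ i * yA ^ j.
    rewrite inE => /orP[/eqP->|]; last exact: elt3_moves.
    by exists 0, 0; rewrite elt3_const rmorph1 !expr0z mulr1.
  suff [b hb' ->] : exists2 b, b \in (1, 0, 0) :: moves A & elt3 a' = emb L c%:P * elt3 b.
    by have [i [j ->]] := scale b hb'; exists i, j.
  move: ha; rewrite !inE => /or4P[] /eqP->.
  - by exists (1, 0, 0); rewrite ?inE ?eqxx // !elt3_const rmorph1 mulr1.
  - by exists (y3 {poly F}); rewrite ?inE ?eqxx ?orbT // /elt3 /y3 !(rmorph0, rmorph1); ring.
  - exists (yD3 A); rewrite ?inE ?eqxx ?orbT // /elt3 /yD3 !(rmorph0, rmorph1, rmorphM) /=; ring.
  - exists (yD3 (- A)); rewrite ?inE ?eqxx ?orbT // /elt3 /yD3.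
    by rewrite !(rmorph0, rmorph1, rmorphN, rmorphM) /=; ring.
elim: n a => [|n IH] a hb hN; first exact: base (bounded3W (leq0n _) hb) hN.
have [hn|hn] := leqP (size A) n; last exact: base (bounded3W hn hb) hN.
have [hb'|[b bm hb']] := descent_step F2 hA hn hb hN; first exact: IH.
have [|c [i [j [c0 e]]]] := IH _ hb'.
  by rewrite norm3M (norm3_moves bm) mul1r.
have [i' [j' e']] := elt3_moves bm.
exists c, (i - i'), (j - j'); split=> //.
rewrite (elt3M hy) e' in e.
apply: (mulfI (x := y ^ i' * yA ^ j')); first by rewrite mulf_neq0 ?expfz_neq0.
rewrite e [RHS]mulrCA [in RHS]mulrACA -!expfzDr //.
by rewrite ![_ + (_ - _)]addrC !subrK.
Qed.

Lemma leading_power_y n : exists t,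
  [/\ elt3 t = y ^+ n, leading3 A n t & leading3 (- A) n t].
Proof.
elim: n => [|n [t [e l1 l2]]].
  exists (1, 0, 0); rewrite elt3_const rmorph1 expr0; split=> //; exact: leading3_1.
exists (mul3 A (y3 _) t); split.
- rewrite (elt3M hy) e exprS; congr (_ * _).
  by rewrite /elt3 /y3 !rmorph0 rmorph1 mul0r mul1r addr0 add0r.
- exact: leading3_y.
- by rewrite -mul3N; apply: leading3_y; rewrite ?size_polyN.
Qed.

(** The second bound tells $(A+y)^m$ from $y^m$ when $m > 0$. *)
Lemma leading_power n m : exists t,
  [/\ elt3 t = y ^+ n * yA ^+ m, leading3 A (n + m) t
    & (0 < m)%N -> (size (value3 (- A) t) <= (n + m) * (size A).-1)%N].
Proof.
elim: m => [|m [t [e l1 _]]].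
  by have [t [e l1 _]] := leading_power_y n; exists t; rewrite addn0 expr0 mulr1.
have [l3 l4] := leading3_yD F2 hA l1.
exists (mul3 A (yD3 A) t); rewrite addnS; split=> // [|_].
  rewrite (elt3M hy) e exprSr [RHS]mulrA [LHS]mulrC; congr (_ * _).
  by rewrite /elt3 /yD3 rmorph0 rmorph1 mul0r mul1r addr0.
by apply: leq_trans l4 _; rewrite mulSn leq_addl.
Qed.

Lemma power_degree n m n' m' : y ^+ n * yA ^+ m = y ^+ n' * yA ^+ m' ->
  (n + m = n' + m')%N.
Proof.
have [t [e /andP[_ /eqP l] _]] := leading_power n m.
have [t' [e' /andP[_ /eqP l'] _]] := leading_power n' m'.
rewrite -e -e' => /(elt3_inj F2 hy hA) tt'; move: l l'; rewrite tt' => -> [] /eqP.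
have d0 : (0 < (size A).-1)%N by case: (size A) hA => [|[]].
by rewrite eqn_pmul2r // => /eqP.
Qed.

Lemma power_neq n m : y ^+ n = yA ^+ m -> n = 0%N /\ m = 0%N.
Proof.
move=> h; have hnm : n = m.
  by have := @power_degree n 0 0 m; rewrite !expr0 mulr1 mul1r addn0 => /(_ h).
suff m0 : m = 0%N by rewrite hnm m0.
rewrite hnm in h; case: m {n hnm} h => // m h.
have [t [e _ /andP[_ /eqP l]]] := leading_power_y m.+1.
have [t' [e' _ /(_ isT) l']] := leading_power 0 m.+1.
have tt' : t = t' by apply: (elt3_inj F2 hy hA); rewrite e e' mul1r.
by move: l'; rewrite -tt' l size_polyN add0n ltnn.
Qed.

Lemma power_independent (i j : int) : y ^ i * yA ^ j = 1 -> i = 0 /\ j = 0.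
Proof.
have y0 := y_neq0; have yA0 := yA_neq0.
have mv (u v : L) : v != 0 -> u * v^-1 = 1 -> u = v.
  by move=> v0 /(congr1 ( *%R^~ v)); rewrite mulfVK // mul1r.
case: i j => [n|n] [m|m]; rewrite ?NegzE -?exprnN -?exprnP.
- by move=> h; have := @power_degree n m 0 0; rewrite h !expr0 mulr1 => /(_ erefl); lia.
- by move=> /mv-/(_ (expf_neq0 _ yA0))/power_neq[].
- by rewrite mulrC => /mv-/(_ (expf_neq0 _ y0))/esym/power_neq[].
- rewrite -invfM => /(congr1 GRing.inv); rewrite invrK invr1 => h.
  by have := @power_degree n.+1 m.+1 0 0; rewrite h !expr0 mulr1 => /(_ erefl).
Qed.

End Units.

(** * The unit group *)

Section UnitGroup.
Variables (F : finFieldType) (L : fieldExtType {fraction {poly F}}).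
Implicit Types (u w : L).

Lemma order_unitM u w : order_unit u -> order_unit w -> order_unit (u * w).
Proof.
move=> [iu [u' iu' uu']] [iw [w' iw' ww']]; split; first exact: integral_mul.
by exists (u' * w'); [exact: integral_mul | rewrite mulrACA uu' ww' mulr1].
Qed.

Lemma order_unitV u : order_unit u -> order_unit u^-1.
Proof.
move=> [iu [u' iu' uu']].
have u0 : u != 0 by apply: contra_eq_neq uu' => ->; rewrite mul0r eq_sym oner_eq0.
have -> : u^-1 = u' by apply: (mulfI u0); rewrite mulfV // uu'.
by split=> //; exists u; rewrite // mulrC.
Qed.

Lemma order_unitX u (n : nat) : order_unit u -> order_unit (u ^+ n).
Proof.
move=> hu; elim: n => [|n IH]; last by rewrite exprS; apply: order_unitM.
have i1 : in_order (1 : L) by exact: integral1.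
by rewrite expr0; split=> //; exists 1; rewrite // mulr1.
Qed.

Lemma order_unitXz u (n : int) : order_unit u -> order_unit (u ^ n).
Proof.
move=> hu; case: n => n; first exact: order_unitX.
by rewrite NegzE -exprnN; apply/order_unitV/order_unitX.
Qed.

Lemma monomial2 (u w : L) (k : 'I_2 -> int) :
  monomial [tuple u; w] k = u ^ k ord0 * w ^ k (lift ord0 ord0).
Proof. by rewrite /monomial !big_ord_recl big_ord0 mulr1. Qed.

End UnitGroup.

Theorem theorem2p4p7 (F : finFieldType)
    (hchar : exists2 p : nat, p \in [pchar F] & (5 <= p)%N)
    (L : fieldExtType {fraction {poly F}}) (y : L) (A : {poly F})
    (hL : <<1%VS; y>>%VS = fullv)
    (hy : y ^+ 3 = emb L A ^+ 2 * y + 1)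
    (hA : (1 < size A)%N)
    (hD : squarefree (4%:R *: A ^+ 6 - 27%:R%:P))
    (v1 : L -> \bar int) (hv1 : minimal_place A y v1)
    (hunits : ~ exists a0 a1 a2 : {poly F},
        [/\ order_unit (emb L a0 + emb L a1 * y + emb L a2 * y ^+ 2),
            ((deg A)%:E < max_value v1 y a0 a1 a2)%E
          & (max_value v1 y a0 a1 a2 < (2 * deg A)%R%:E)%E]) :
  unit_rank L 2 /\ fundamental_system [tuple y; emb L A + y].
Proof.
have F2 : 2%:R != 0 :> F.
  have [p charp p5] := hchar; rewrite -(dvdn_pcharf charp).
  by apply/negP => /dvdn_leq; lia.
have y0 := y_neq0 hy; have yA0 := yA_neq0 hy; have rel := y_relation hy.
have iA : in_order (emb L A) by exact: integral_id.
have iy : in_order y by exact: (@integral_cubic_root _ A _ (emb L)).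
have iyA : in_order (emb L A + y) by exact: integral_add.
have iyB : in_order (y - emb L A) by exact: integral_sub.
have uy : order_unit y.
  by split=> //; exists ((y - emb L A) * (emb L A + y)); [exact: integral_mul|rewrite mulrA].
have uyA : order_unit (emb L A + y).
  by split=> //; exists (y * (y - emb L A)); [exact: integral_mul|rewrite mulrC].
set s := [tuple y; emb L A + y].
have us (i : 'I_2) : order_unit (tnth s i).
  by rewrite (tnth_nth 0); case: i => -[|[|]].
have indep : independent s.
  move=> k; rewrite monomial2 => /(power_independent F2 hy hA)[k0 k1].
  move=> i; case: (unliftP ord0 i) => [j ->|->] //.
  by rewrite (ord1 j).
have gen u : order_unit u -> exists c (k : 'I_2 -> int), const_unit c /\ u = c * monomial s k.
  move=> hu; have [a uE] := integral_basis F2 hL hy hA hD hu.1.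
  rewrite uE in hu *.
  have hN := norm3_unit F2 hL hy hA hu hD.
  have [n hb] : exists n, bounded3 A n a.
    case: (a) => -[a0 a1] a2.
    exists (size a0 + size (A * a1)%R + size (A ^+ 2 * a2)%R)%N.
    by apply/and3P; split;
      [rewrite -addnA leq_addr | rewrite addnAC leq_addl | rewrite leq_addl].
  have [c [i [j [c0 ->]]]] := norm1_generated F2 hy hA hb hN.
  exists (emb L c%:P), (fun l => if l == ord0 then i else j); split; first by exists c.
  by rewrite monomial2.
have monomial_unit k : order_unit (monomial s k).
  by rewrite monomial2; apply: order_unitM; apply: order_unitXz.
split=> //.
exists (fun u => exists k : 'I_2 -> int, u = monomial s k); split.
- by move=> u [k ->].
- move=> u [k uE] [c c0 uc].
  (* A constant is a root of unity, and the monomials are torsion free. *)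
  have uq : u ^+ #|F| = u by rewrite uc -rmorphXn -polyC_exp expf_card.
  have u0 : u != 0.
    by rewrite uc -(rmorph0 (emb L)) (inj_eq (@emb_inj _ L)) polyC_eq0.
  have hq : (1 < #|F|)%N := finNzRing_gt1 F.
  have uq1 : u ^+ #|F|.-1 = 1.
    by apply: (mulfI u0); rewrite mulr1 -exprS prednK // ltnW.
  have k0 : forall i, k i * (#|F|.-1)%:Z = 0.
    apply: indep; rewrite -uq1 uE !monomial2 exprMn.
    by rewrite -!exprz_exp.
  have {}k0 i : k i = 0.
    by have /eqP := k0 i; rewrite mulf_eq0 => /orP[/eqP//|]; lia.
  by rewrite uE monomial2 !k0 !expr0z mulr1.
- by move=> u /gen[c [k [hc ->]]]; exists c, (monomial s k); split=> //; exists k.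
- exists s; split=> // i; rewrite (tnth_nth 0).
  by case: i => -[|[|]].
Qed.
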